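(* Let $(\mathfrak{g},\langle\,,\rangle)$ be a three-dimensional semi-symmetric Lorentzian Lie algebra of type $(S30\lambda)$, so that $\mathfrak{g}=\mathfrak{g}_0\oplus\mathfrak{g}_\lambda$ with $\lambda\neq0$ and $\dim\mathfrak{g}_0=1$. Then $\mathfrak{g}_0.\mathfrak{g}=\mathfrak{g}.\mathfrak{g}_0=0$, $\mathfrak{g}_\lambda$ is an ideal for the Levi-Civita product, and hence $\mathfrak{g}$ is a product, as a Lie algebra, of $\mathfrak{g}_0$ with $\mathfrak{g}_\lambda$.
   Context: A Lorentzian Lie algebra is a finite-dimensional real Lie algebra $\mathfrak{g}$ with a nondegenerate inner product of signature $(1,n-1)$. Its Levi-Civita product $u.v=\mathrm{L}_uv$ is defined by $2\langle \mathrm{L}_uv,w\rangle=\langle[u,v],w\rangle+\langle[w,u],v\rangle+\langle[w,v],u\rangle$. The curvature is $K(u,v)=\mathrm{L}_{[u,v]}-[\mathrm{L}_u,\mathrm{L}_v]$, and the Ricci operator is defined by $\langle\mathrm{Ric}(u),v\rangle=\mathrm{tr}(a\mapsto K(u,a)v)$. The Lie algebra is semi-symmetric if $[K(u,v),K(a,b)]=K(K(u,v)a,b)+K(a,K(u,v)b)$ for all $u,v,a,b$. Put $\mathfrak{g}_0=\ker(\mathrm{Ric}^2)$ and, for $\lambda\neq0$, $\mathfrak{g}_\lambda=\ker(\mathrm{Ric}-\lambda\mathrm{Id})$. Type $(S30\lambda)$: $\dim\mathfrak{g}=3$, $\mathfrak{g}=\mathfrak{g}_0\oplus\mathfrak{g}_\lambda$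 (orthogonal sum) with $\dim\mathfrak{g}_0=1$, $\mathfrak{g}_0.\mathfrak{g}_\lambda\subset\mathfrak{g}_\lambda$, $\mathfrak{g}_0.\mathfrak{g}_0\subset\mathfrak{g}_0$ and $\lambda\neq0$. *)

(* Defs.v *)
From HB Require Import structures.
From mathcomp Require Import all_boot all_order all_algebra.
From mathcomp Require Import sesquilinear reals ring.

Set Implicit Arguments.
Unset Strict Implicit.
Unset Printing Implicit Defensive.

Import GRing.Theory Num.Theory.
Local Open Scope ring_scope.

Record lorentzLieAlgebra (R : realType) := LorentzLieAlgebra {
  carrier :> vectType R;
  bracket : {bilinear carrier -> carrier -> carrier};
  bracket_alt : forall u, bracket u u = 0;
  bracket_jacobi : forall u v w,
    bracket u (bracket v w) + bracket v (bracket w u)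
      + bracket w (bracket u v) = 0;
  ip : {symmetric carrier};
  ip_nondegenerate : forall u, (forall v, ip u v = 0) -> u = 0;
  (* signature (1, n-1): one minus sign, n-1 plus signs *)
  ip_signature : exists2 b : (\dim {:carrier}).-tuple carrier,
    basis_of fullv b
    & (0 < \dim {:carrier})%N /\
      forall i j, ip (tnth b i) (tnth b j)
                  = (-1) ^+ (val i == 0%N) * (i == j)%:R
}.

Arguments bracket {R} _.
Arguments ip {R} _.

Section LorentzLieAlgebraTheory.
Variables (R : realType) (g : lorentzLieAlgebra R).
Implicit Types (u v w a b x : g) (U V : {vspace g}) (lam : R).

Local Notation "[[ u , v ]]" := (bracket g u v) (at level 0).
Local Notation "<< u , v >>" := (ip g u v) (at level 0).

(* [riesz phi] is the vector representing the linear form phi for the inner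
   product, see [rieszE]. *)
Definition flat : 'Hom(g, 'Hom(g, R^o)) :=
  linfun (fun u => linfun (fun v => <<u, v>> : R^o)).

Definition riesz (phi : g -> R^o) : g := (flat^-1)%VF (linfun phi).

Definition koszul_form u v w : R^o :=
  2^-1 * (<<[[u, v]], w>> + <<[[w, u]], v>> + <<[[w, v]], u>>).

(* [linfun f] is meaningful only for linear f; the functions it is applied to
   below are linear, see [levi_civitaE] and [ricciE]. *)
Definition levi_civita u : 'End(g) := linfun (fun v => riesz (koszul_form u v)).

Local Notation "u ** v" := (levi_civita u v) (at level 40).

Definition lie_comm (f h : 'End(g)) : 'End(g) := (f \o h)%VF - (h \o f)%VF.

Definition curvature u v : 'End(g) :=
  levi_civita [[u, v]] - lie_comm (levi_civita u) (levi_civita v).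

Definition trace (f : 'End(g)) : R :=
  \tr (passmx.mxof (vbasis {:g}) (vbasis {:g}) f).

Definition ricci_form u v : R^o := trace (linfun (fun a => curvature u a v)).

Definition ricci : 'End(g) := linfun (fun u => riesz (ricci_form u)).

Definition semi_symmetric : Prop := forall u v a b,
  lie_comm (curvature u v) (curvature a b)
  = curvature (curvature u v a) b + curvature a (curvature u v b).

Definition ricci_space0 : {vspace g} := lker (ricci \o ricci)%VF.

Definition ricci_space lam : {vspace g} := lker (ricci - lam *: \1%VF).

Definition orthogonal_sum U V : Prop :=
  [/\ (U + V)%VS = fullv, directv (U + V)
    & {in U & V, forall u v, <<u, v>> = 0}].

Definition type_S30 lam : Prop :=
  [/\ \dim {:g} = 3%N, lam != 0, orthogonal_sum ricci_space0 (ricci_space lam) & \dim ricci_space0 = 1%N]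
  /\ {in ricci_space0 & ricci_space lam, forall u v, u ** v \in ricci_space lam}
  /\ {in ricci_space0 & ricci_space0, forall u v, u ** v \in ricci_space0}.

Definition levi_civita_ideal V : Prop :=
  forall u v, v \in V -> u ** v \in V /\ v ** u \in V.

Definition lie_subalgebra V : Prop := {in V & V, forall u v, [[u, v]] \in V}.

(* g is the product of the Lie algebras U and V: the map (x, y) |-> x + y is
   an isomorphism onto g from U * V with the componentwise bracket. *)
Definition lie_product U V : Prop :=
  [/\ lie_subalgebra U, lie_subalgebra V,
      (U + V)%VS = fullv /\ directv (U + V)
    & forall x1 x2 y1 y2, x1 \in U -> x2 \in U -> y1 \in V -> y2 \in V ->
        [[x1 + y1, x2 + y2]] = [[x1, x2]] + [[y1, y2]]].

Lemma linfunP (W : vectType R) (f : g -> W) : linear f -> linfun f =1 f.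
Proof.
move=> fP x.
pose fL := GRing.isSemilinear.Build R g W *:%R f (GRing.semilinear_linear fP).
pose fH : {linear g -> W} := HB.pack f fL.
exact: (lfunE fH).
Qed.

Lemma flatE u v : flat u v = <<u, v>>.
Proof.
have ipP x : linear (fun v => <<x, v>> : R^o).
  by move=> a y z; rewrite linearPr.
rewrite /flat linfunP ?linfunP // => a x y.
apply/lfunP => z; rewrite add_lfunE scale_lfunE !linfunP //.
by rewrite linearDl linearZl_LR.
Qed.

Lemma lker_flat : lker flat == 0%VS.
Proof.
apply/lker0P => u v uv; apply/eqP; rewrite -subr_eq0; apply/eqP.
apply: ip_nondegenerate => w.
by rewrite linearBl /= -!flatE uv subrr.
Qed.

Lemma rieszE (phi : g -> R^o) x : linear phi -> <<riesz phi, x>> = phi x.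
Proof.
move=> phiP; rewrite -flatE /riesz limg_lfunVK ?linfunP //.
suff -> : limg flat = fullv by rewrite memvf.
apply/eqP; rewrite eqEdim subvf /=.
by rewrite limg_dim_eq ?(eqP lker_flat) ?capv0 // !dimvf /dim /= muln1.
Qed.

Lemma ip_inj u v : (forall w, <<u, w>> = <<v, w>>) -> u = v.
Proof.
move=> uv; apply/eqP; rewrite -subr_eq0; apply/eqP/ip_nondegenerate => w.
by rewrite linearBl /= uv subrr.
Qed.

Let ipl (c : R) x y z : <<c *: x + y, z>> = c * <<x, z>> + <<y, z>>.
Proof. by rewrite linearDl linearZl_LR. Qed.
Let ipr (c : R) x y z : <<z, c *: x + y>> = c * <<z, x>> + <<z, y>>.
Proof. by rewrite linearDr linearZr_LR. Qed.
Let brl (c : R) x y z : [[c *: x + y, z]] = c *: [[x, z]] + [[y, z]].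
Proof. by rewrite linearDl linearZl_LR. Qed.
Let brr (c : R) x y z : [[z, c *: x + y]] = c *: [[z, x]] + [[z, y]].
Proof. by rewrite linearDr linearZr_LR. Qed.
Let regE (a : R) (x y : R^o) : a *: x + y = (a * x + y : R).
Proof. by []. Qed.

Lemma levi_civitaE u v w :
  2 * <<u ** v, w>> = <<[[u, v]], w>> + <<[[w, u]], v>> + <<[[w, v]], u>>.
Proof.
have kP x y : linear (koszul_form x y).
  by move=> a z t; rewrite regE /koszul_form !(brl, ipl, ipr); ring.
rewrite linfunP; first by rewrite rieszE // /koszul_form mulVKf // pnatr_eq0.
move=> a x y; apply: ip_inj => z; rewrite ipl !rieszE //.
by rewrite /koszul_form !(brl, brr, ipl, ipr); ring.
Qed.

Lemma levi_civita_linear : linear levi_civita.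
Proof.
move=> a x y; apply/lfunP => v; rewrite add_lfunE scale_lfunE.
apply: ip_inj => w; apply: (@mulfI _ 2); first by rewrite pnatr_eq0.
rewrite ipl mulrDr mulrCA !levi_civitaE !(brl, brr, ipl, ipr); ring.
Qed.

Let curvatureE u v w :
  curvature u v w = [[u, v]] ** w - (u ** (v ** w) - v ** (u ** w)).
Proof.
by rewrite /curvature /lie_comm !(add_lfunE, opp_lfunE, comp_lfunE).
Qed.

Let ipB x y z : <<x - y, z>> = <<x, z>> - <<y, z>>.
Proof. by rewrite linearBl. Qed.

Lemma curvature_linearl v : linear (curvature^~ v).
Proof.
move=> c x y; apply/lfunP => w; apply: ip_inj => z.
rewrite curvatureE brl add_lfunE scale_lfunE ipl !curvatureE !levi_civita_linear.
by rewrite !(add_lfunE, scale_lfunE) linearP /= !(ipB, ipl); ring.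
Qed.

Lemma curvature_linearr u : linear (curvature u).
Proof.
move=> c x y; apply/lfunP => w; apply: ip_inj => z.
rewrite curvatureE brr add_lfunE scale_lfunE ipl !curvatureE !levi_civita_linear.
by rewrite !(add_lfunE, scale_lfunE) linearP /= !(ipB, ipl); ring.
Qed.

Lemma trace_linear (c : R) f h : trace (c *: f + h) = c * trace f + trace h.
Proof. by rewrite /trace passmx.mxof_linear mxtraceD mxtraceZ. Qed.

Lemma ricciE u v :
  <<ricci u, v>> = trace (linfun (fun a => curvature u a v)).
Proof.
have cP x y : linear (fun a => curvature x a y).
  by move=> c a b; rewrite curvature_linearr add_lfunE scale_lfunE.
have rP x : linear (ricci_form x).
  move=> c y z; rewrite /ricci_form -trace_linear; congr (trace _ : R^o).
  apply/lfunP => a; rewrite add_lfunE scale_lfunE.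
  by rewrite !(linfunP (cP _ _)) linearP.
rewrite /ricci linfunP ?rieszE // => c x y; apply: ip_inj => z.
rewrite ipl !rieszE // /ricci_form -trace_linear; congr (trace _ : R).
apply/lfunP => a; rewrite add_lfunE scale_lfunE !(linfunP (cP _ _)).
by rewrite curvature_linearl add_lfunE scale_lfunE.
Qed.

End LorentzLieAlgebraTheory.

(* Main.v *)
(* Ric vanishes on the line g_0 = R e and is lam on the plane g_lam. In
   dimension 3 this forces K(e, f) = 0 for f in g_lam, and K <> 0 on g_lam.
   Writing D = L_e and A f = f.e on g_lam, the equation K(e, f)e = 0 becomes
   A D - D A = A^2, so tr A^2 = tr A^3 = 0 and A is nilpotent. If D <> 0, then A
   commutes with D (tr A = 0 makes A^2 = 0), so A = 0; if D = 0 and A <> 0, the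
   remaining components of K(e, f) = 0 and K(f1, f2)e = 0 make K flat, a
   contradiction. Once A = 0, K(e, f) = 0 and K <> 0 give D = 0. *)
From HB Require Import structures.
Require Import Defs.
From mathcomp Require Import all_boot all_order all_algebra.
From mathcomp Require Import sesquilinear reals ring.

Set Implicit Arguments.
Unset Strict Implicit.
Unset Printing Implicit Defensive.

Import GRing.Theory Num.Theory.
Local Open Scope ring_scope.

(** * The polynomial system satisfied by the connection coefficients *)

Lemma eq0_lincomb2 (D : comNzRingType) (c d x a b : D) :
  a = 0 -> b = 0 -> x = c * a + d * b -> x = 0.
Proof. by move=> -> ->; rewrite !mulr0 addr0. Qed.
Arguments eq0_lincomb2 {D} c d {x a b}.

(** Up to products of the norms p, q, r of e, f1, f2, the nine equalities to 0 or inequalities are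
    curvature components: the first six express K(e, f1) = K(e, f2) = 0, the next two that K(f1,
    f2)e is orthogonal to the plane's basis, and the last that K(f1, f2) is nonzero on the plane. *)
Lemma flat_axis_coefs (D : numDomainType) (p q r B11 B12 B21 B22 m1 m2 d : D) :
  p != 0 -> q != 0 -> r != 0 ->
  - p * B11 * B11 + (d * q - p * B12) * B21 + B12 * d * r = 0 ->
  - p * B11 * B12 + (d * q - p * B12) * B22 - B11 * d * q = 0 ->
  - p * B11 * m1 + (d * q - p * B12) * m2 = 0 ->
  - (d * r + p * B21) * B11 - p * B22 * B21 + B22 * d * r = 0 ->
  - (d * r + p * B21) * B12 - p * B22 * B22 - B21 * d * q = 0 ->
  - (d * r + p * B21) * m1 - p * B22 * m2 = 0 ->
  - m1 * r * B11 - m2 * q * B21 + B22 * m1 * r - B12 * m2 * r = 0 ->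
  - m1 * r * B12 - m2 * q * B22 - (B21 * m1 * q - B11 * m2 * q) = 0 ->
  - m1 * m1 * r - m2 * m2 * q + (B21 * q - B12 * r) * d
    + p * (B21 * B12 - B11 * B22) != 0 ->
  [/\ B11 = 0, B12 = 0, B21 = 0, B22 = 0 & d = 0].
Proof.
move=> p0 q0 r0 E11 E12 E1 E21 E22 E2 F1 F2 k0.
have cancel (a x : D) : a != 0 -> a * x = 0 -> x = 0.
  by move=> a0 /eqP; rewrite mulf_eq0 (negPf a0) => /eqP.
have sq (x : D) : x * x = 0 -> x = 0 by move=> /eqP; rewrite mulf_eq0 orbb => /eqP.
have two0 : (2 : D) != 0 by rewrite pnatr_eq0.
(* E11, E12, E21, E22 say D B - B D = p B^2 with D = [[0, d q], [- d r, 0]],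
   hence tr B^2 = tr B^3 = 0. *)
have tr2 : B11 * B11 + 2 * B12 * B21 + B22 * B22 = 0.
  by apply: (cancel p) => //; apply: (eq0_lincomb2 (-1) (-1) E11 E22); ring.
have tr3 : B11 * B11 * B11 + 3 * (B12 * B21) * (B11 + B22)
           + B22 * B22 * B22 = 0.
  apply: (cancel p) => //.
  (* [H1] and [H2] are the diagonal entries of (D B - B D - p B^2) B. In their sum D cancels by
     cyclicity of the trace, leaving - p tr B^3. *)
  have H1 : B11 * (- p * B11 * B11 + (d * q - p * B12) * B21 + B12 * d * r)
    + B21 * (- p * B11 * B12 + (d * q - p * B12) * B22 - B11 * d * q) = 0.
    by rewrite E11 E12 !mulr0 addr0.
  have H2 : B12 * (- (d * r + p * B21) * B11 - p * B22 * B21 + B22 * d * r)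
    + B22 * (- (d * r + p * B21) * B12 - p * B22 * B22 - B21 * d * q) = 0.
    by rewrite E21 E22 !mulr0 addr0.
  by apply: (eq0_lincomb2 (-1) (-1) H1 H2); ring.
have tr0 : B11 + B22 = 0.
  set t := B11 + B22.
  (* Newton's identity for two eigenvalues: t^3 = 3 t tr B^2 - 2 tr B^3. *)
  have t3 : t * (t * t) = 0.
    by rewrite /t; apply: (eq0_lincomb2 (3 * (B11 + B22)) (- 2) tr2 tr3); ring.
  apply: sq; move: t3 => /eqP; rewrite mulf_eq0 => /orP[/eqP-> | /eqP //].
  by rewrite mulr0.
have B22E : B22 = - B11 by apply/eqP; rewrite -addr_eq0 addrC tr0.
move: E11 E12 E1 E21 E22 E2 F1 F2 k0 tr2; rewrite {tr3 tr0}B22E.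
move=> E11 E12 E1 E21 E22 E2 F1 F2 k0 tr2.
have det0 : B11 * B11 + B12 * B21 = 0.
  by apply: (cancel 2) => //; apply: (eq0_lincomb2 1 0 tr2 tr2); ring.
have dS : d * (q * B21 + r * B12) = 0.
  by apply: (eq0_lincomb2 1 p E11 det0); ring.
have dB : d * B11 = 0.
  apply: (cancel (2 * q)); first by rewrite mulf_neq0.
  by apply: (eq0_lincomb2 (-1) 0 E12 E12); ring.
(* Once B = 0, [E1] and [E2] reduce to d q m2 = 0 and d r m1 = 0, so a nonzero d would force m1 = m2
   = 0, against [k0]. *)
suff [B11_0 B12_0 B21_0] : [/\ B11 = 0, B12 = 0 & B21 = 0].
  rewrite B11_0 B12_0 B21_0 oppr0; split=> //; apply/eqP/negP => /negP d0.
  have m2_0 : m2 = 0.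
    apply: (cancel (d * q)); first by rewrite mulf_neq0.
    by rewrite -E1 B11_0 B12_0; ring.
  have m1_0 : m1 = 0.
    apply: (cancel (- d * r)); first by rewrite mulf_neq0 // oppr_eq0.
    by rewrite -E2 B11_0 B21_0; ring.
  by case/eqP: k0; rewrite m1_0 m2_0 B11_0 B12_0 B21_0; ring.
(* For nonzero d, D is invertible and commutes with B, so the trace-free B is a multiple of D; being
   nilpotent, it vanishes. *)
have [d_eq0|d0] := eqVneq d 0; last first.
  have B11_0 := cancel _ _ d0 dB.
  have S0 := cancel _ _ d0 dS.
  move: det0; rewrite B11_0 mulr0 add0r => det0.
  split=> //; apply: sq.
    by apply: (cancel r) => //; apply: (eq0_lincomb2 B12 (- q) S0 det0); ring.
  by apply: (cancel q) => //; apply: (eq0_lincomb2 B21 (- r) S0 det0); ring.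
move: E1 E2 k0 => {E11 E12 E21 E22 dS dB}; rewrite {}d_eq0 => E1 E2 k0.
(* For d = 0, the vector (m1, m2) lies in the kernel of B and the row (r m1, q m2) annihilates B
   from the left ([G1], [G2]). A nonzero B with B^2 = 0 has image equal to kernel, so the row would
   annihilate (m1, m2), against [k0]. *)
have m_1 : B11 * m1 + B12 * m2 = 0.
  by apply: (cancel p) => //; apply: (eq0_lincomb2 (-1) 0 E1 E1); ring.
have m_2 : B21 * m1 - B11 * m2 = 0.
  by apply: (cancel p) => //; apply: (eq0_lincomb2 (-1) 0 E2 E2); ring.
have {}k0 : m1 * m1 * r + m2 * m2 * q != 0.
  apply: contra_neq k0 => k0.
  by apply: (eq0_lincomb2 (-1) p k0 det0); ring.
have G1 : m1 * r * B11 + m2 * q * B21 = 0.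
  by apply: (eq0_lincomb2 (-1) (- r) F1 m_1); ring.
have G2 : m1 * r * B12 - m2 * q * B11 = 0.
  by apply: (eq0_lincomb2 (-1) (- q) F2 m_2); ring.
split; apply: (cancel _ _ k0).
- by apply: (eq0_lincomb2 m1 (- m2 * q) G1 m_2); ring.
- by apply: (eq0_lincomb2 m1 (m2 * q) G2 m_1); ring.
- by apply: (eq0_lincomb2 m2 (m1 * r) G1 m_2); ring.
Qed.

(** * Metric connection, curvature, traces and orthogonal bases *)

Section LeviCivita.
Variables (R : realType) (g : lorentzLieAlgebra R).
Implicit Types (u v w x y : g) (U : {vspace g}) (lam : R).

Local Notation "[[ u , v ]]" := (bracket g u v) (at level 0).
Local Notation "<< u , v >>" := (ip g u v) (at level 0).
Local Notation "u ** v" := (levi_civita u v) (at level 40).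

HB.instance Definition _ := GRing.isSemilinear.Build R g 'End(g) *:%R
  (@levi_civita R g) (GRing.semilinear_linear (@levi_civita_linear R g)).

Lemma ipC u v : <<u, v>> = <<v, u>>.
Proof. by rewrite (hermC (ip g)) expr0 mul1r. Qed.

Lemma bracketC u v : [[u, v]] = - [[v, u]].
Proof.
apply/eqP; rewrite -addr_eq0; have := bracket_alt (u + v).
by rewrite linearDl !linearDr /= !bracket_alt add0r addr0 => ->.
Qed.

(** Metric compatibility: exchanging v and w changes the sign of Koszul's formula. *)
Lemma levi_civita_skew u v w : <<u ** v, w>> = - <<v, u ** w>>.
Proof.
apply: (@mulfI _ 2); first by rewrite pnatr_eq0.
rewrite mulrN [in RHS]ipC !levi_civitaE (bracketC v w) (bracketC v u).
by rewrite (bracketC w u) !linearNl /=; ring.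
Qed.

Lemma bracketE u v : [[u, v]] = u ** v - v ** u.
Proof.
apply: ip_inj => w; apply: (@mulfI _ 2); first by rewrite pnatr_eq0.
rewrite linearBl /= mulrBr !levi_civitaE (bracketC v u) linearNl /=; ring.
Qed.

(** Skewness moves the outer factor of each double product onto x, which avoids iterated products in
    frame computations. *)
Lemma curvature_ip u v w x :
  <<curvature u v w, x>> =
    <<[[u, v]] ** w, x>> + <<v ** w, u ** x>> - <<u ** w, v ** x>>.
Proof.
rewrite /curvature /lie_comm !(add_lfunE, opp_lfunE, comp_lfunE).
rewrite !(linearBl, linearDl, linearNl) /= !(levi_civita_skew u (_ ** _)).
by rewrite !(levi_civita_skew v (_ ** _)); ring.
Qed.

Lemma curvature_alt u : curvature u u = 0.
Proof. by rewrite /curvature bracket_alt linear0 /lie_comm !subrr. Qed.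

Lemma curvatureC u v w : curvature u v w = - curvature v u w.
Proof.
apply: ip_inj => x; rewrite linearNl /= !curvature_ip (bracketC v u).
by rewrite linearN opp_lfunE linearNl /=; ring.
Qed.

Lemma curvature_skew u v w x : <<curvature u v w, x>> = - <<curvature u v x, w>>.
Proof.
rewrite !curvature_ip (levi_civita_skew _ x) (ipC (v ** x)) (ipC (u ** x)).
by rewrite (ipC x); ring.
Qed.

Lemma trace_coord (f : 'End(g)) :
  trace f = \sum_i coord (vbasis {:g}) i (f (vbasis {:g})`_i).
Proof.
rewrite /trace /mxtrace; apply: eq_bigr => i _.
by rewrite !mxE /= passmx.vecof_delta.
Qed.

(** The hypothesis writes the identity as a sum of rank-one maps, so f is the sum of the maps
    sending x to <x, d_i> f(c_i), each of trace <f(c_i), d_i>. *)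
Lemma trace_frame (n : nat) (c d : 'I_n -> g) (f : 'End(g)) :
  (forall x, x = \sum_i <<x, d i>> *: c i) -> trace f = \sum_i <<f (c i), d i>>.
Proof.
move=> frame; set b := vbasis {:g}.
have coordb x : x = \sum_j coord b j x *: b`_j.
  by rewrite -coord_vbasis ?memvf.
rewrite trace_coord -/b.
under eq_bigr => j _ do
  rewrite [in f _](frame b`_j) linear_sum /= linear_sum /=.
rewrite exchange_big; apply: eq_bigr => i _ /=.
rewrite [f (c i) in RHS]coordb linear_sumlz /=; apply: eq_bigr => j _.
by rewrite linearZl_LR !linearZ /= mulrC.
Qed.

(** U may be indefinite, so a given nonzero x can be isotropic. Some y in U then pairs nontrivially
    with x, and if y is isotropic too, x + y has norm 2<x, y>. *)
Lemma nonisotropic_vector U :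
  U != 0%VS -> (forall x, x \in U -> {in U, forall y, <<x, y>> = 0} -> x = 0) ->
  exists2 x, x \in U & <<x, x>> != 0.
Proof.
move=> U0 nondegU; have pU := memv_pick U.
have : vpick U != 0 by rewrite vpick0.
set x := vpick U in pU * => x0.
have [xx|] := eqVneq <<x, x>> 0; last by exists x.
have [y yU xy] : exists2 y, y \in U & y \notin lker (flat g x).
  apply/subvPn; apply: contra x0 => /subvP Ux; apply/eqP/nondegU => // y /Ux.
  by rewrite memv_ker flatE => /eqP.
rewrite memv_ker flatE in xy.
have [yy|] := eqVneq <<y, y>> 0; last by exists y.
exists (x + y); first exact: memvD.
rewrite linearDl !linearDr /= xx yy (ipC y x) add0r addr0 -mulr2n.
by rewrite mulrn_eq0.
Qed.

(** Gram-Schmidt without normalisation, so that definite and Lorentzian planes are treated alike. An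
    isotropic [f2] would be orthogonal to all of U. *)
Lemma orthogonal_plane_basis U : \dim U = 2%N ->
  (forall x, x \in U -> {in U, forall y, <<x, y>> = 0} -> x = 0) ->
  exists f1 f2, [/\ [/\ f1 \in U & f2 \in U],
    [/\ <<f1, f1>> != 0, <<f2, f2>> != 0 & <<f1, f2>> = 0]
    & {in U, forall x, exists a b, x = a *: f1 + b *: f2}].
Proof.
move=> dimU nondegU.
have U0 : U != 0%VS by rewrite -dimv_eq0 dimU.
have [f1 f1U f11] := nonisotropic_vector U0 nondegU.
have f1_0 : f1 != 0 by apply: contra_neq f11 => ->; rewrite linear0l.
have [y yU yf1] : exists2 y, y \in U & y \notin <[f1]>%VS.
  apply/subvPn; apply/negP => /dimvS.
  by rewrite dimU dim_vline f1_0.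
pose f2 := y - (<<y, f1>> / <<f1, f1>>) *: f1.
have f2U : f2 \in U by rewrite memvB ?memvZ.
have f2_0 : f2 != 0.
  by apply: contra yf1; rewrite subr_eq0 => /eqP->; rewrite memvZ ?memv_line.
have f21 : <<f2, f1>> = 0.
  by rewrite linearBl linearZl_LR /= divfK // subrr.
have f12 : <<f1, f2>> = 0 by rewrite ipC.
have free12 : free [:: f1; f2].
  rewrite free_cons seq1_free f2_0 andbT span_seq1; apply/vlineP => -[k f1k].
  by case/eqP: f11; rewrite {1}f1k linearZl_LR /= f21 mulr0.
have basis12 : basis_of U [:: f1; f2].
  rewrite basisEfree free12 dimU /= andbT; apply/span_subvP => z.
  by rewrite !inE => /orP[] /eqP ->.
have span x : x \in U -> exists a b, x = a *: f1 + b *: f2.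
  rewrite -(span_basis basis12) span_cons span_seq1.
  by case/memv_addP => _ /vlineP[a ->] [_ /vlineP[b ->] ->]; exists a, b.
exists f1, f2; split=> //; split=> //.
apply: contra_neq f2_0 => f22; apply: nondegU => // z /span[a [b ->] ].
by rewrite linearDr !linearZr_LR /= f21 f22 !mulr0 addr0.
Qed.

(** * Curvature in an orthogonal frame of a three-dimensional algebra *)

Section OrthogonalFrame.
Variables (e f1 f2 : g).
Hypotheses (e0 : <<e, e>> != 0) (f10 : <<f1, f1>> != 0) (f20 : <<f2, f2>> != 0).
Hypotheses (ef1 : <<e, f1>> = 0) (ef2 : <<e, f2>> = 0) (f12 : <<f1, f2>> = 0).
Hypothesis frame : forall x, exists a b c, x = a *: e + b *: f1 + c *: f2.

Let p := <<e, e>>.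
Let q := <<f1, f1>>.
Let r := <<f2, f2>>.

Let f1e : <<f1, e>> = 0. Proof. by rewrite ipC. Qed.
Let f2e : <<f2, e>> = 0. Proof. by rewrite ipC. Qed.
Let f21 : <<f2, f1>> = 0. Proof. by rewrite ipC. Qed.
Let ipE := (f1e, f2e, f21, ef1, ef2, f12).

Let ipDl x y z : <<x + y, z>> = <<x, z>> + <<y, z>>.
Proof. by rewrite linearDl. Qed.
Let ipDr x y z : <<z, x + y>> = <<z, x>> + <<z, y>>.
Proof. by rewrite linearDr. Qed.
Let ipZl (c : R) x z : <<c *: x, z>> = c * <<x, z>>.
Proof. by rewrite linearZl_LR. Qed.
Let ipZr (c : R) x z : <<z, c *: x>> = c * <<z, x>>.
Proof. by rewrite linearZr_LR. Qed.
Let bilin := (ipDl, ipDr, ipZl, ipZr).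

Lemma frameE x :
  x = (<<x, e>> / p) *: e + (<<x, f1>> / q) *: f1 + (<<x, f2>> / r) *: f2.
Proof.
have [a [b [c ->] ] ] := frame x.
by rewrite !bilin !ipE !mulr0 !addr0 !add0r !mulfK.
Qed.

Lemma skew_eq0 (A : 'End(g)) : (forall x y, <<A x, y>> = - <<A y, x>>) ->
  <<A e, f1>> = 0 -> <<A e, f2>> = 0 -> <<A f1, f2>> = 0 -> A = 0.
Proof.
move=> skew Ae1 Ae2 A12.
have diag x : <<A x, x>> = 0 by apply/eqP; rewrite -eqNr -skew.
have A1e : <<A f1, e>> = 0 by rewrite skew Ae1 oppr0.
have A2e : <<A f2, e>> = 0 by rewrite skew Ae2 oppr0.
have A21 : <<A f2, f1>> = 0 by rewrite skew A12 oppr0.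
have A0 x : (x = e \/ x = f1 \/ x = f2) -> A x = 0.
  move=> xE; rewrite [LHS]frameE.
  case: xE => [->|[->|->] ]; rewrite !diag ?Ae1 ?Ae2 ?A12 ?A1e ?A2e ?A21;
    by rewrite !mul0r !scale0r !addr0.
apply/lfunP => x; rewrite zero_lfunE (frameE x) !linearD /= !linearZ /=.
by rewrite !A0 ?scaler0 ?addr0; tauto.
Qed.

Lemma ricci_frame u v :
  <<ricci g u, v>> = <<curvature u e v, e>> / p + <<curvature u f1 v, f1>> / q
    + <<curvature u f2 v, f2>> / r.
Proof.
pose c := [tuple e; f1; f2]; pose d := [tuple p^-1 *: e; q^-1 *: f1; r^-1 *: f2].
rewrite ricciE (@trace_frame _ (tnth c) (tnth d)); last first.
  move=> x; rewrite {1}[x]frameE !big_ord_recl big_ord0 !(tnth_nth 0) /=.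
  by rewrite !ipZr addr0 addrA ![_^-1 * _]mulrC.
have lin : linear (fun a => curvature u a v).
  by move=> k a b; rewrite curvature_linearr add_lfunE scale_lfunE.
rewrite !big_ord_recl big_ord0 !(tnth_nth 0) /= !(linfunP lin) !ipZr addr0 addrA.
by rewrite ![_^-1 * _]mulrC.
Qed.

(** In dimension 3 Ricci determines the curvature: its diagonal entries give a linear system for the
    three sectional components, and each off-diagonal entry contains a single curvature component.
    Both orders of each pair are used, in place of the pair symmetry of K. *)
Lemma curvature_split (lam : R) :
    ricci g e = 0 -> ricci g f1 = lam *: f1 -> ricci g f2 = lam *: f2 ->
  [/\ curvature e f1 = 0, curvature e f2 = 0, <<curvature f1 f2 e, f1>> = 0,
    <<curvature f1 f2 e, f2>> = 0
    & <<curvature f1 f2 f1, f2>> = lam * q * r].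
Proof.
move=> Re Rf1 Rf2.
(* Rewriting with an abstract K keeps unification from unfolding [curvature]. *)
have [K KE] : exists K : g -> g -> g -> g -> R,
  forall u v w x, K u v w x = <<curvature u v w, x>> by eexists.
have K_skew u v w x : K u v w x = - K u v x w by rewrite !KE curvature_skew.
have KC u v w x : K u v w x = - K v u w x by rewrite !KE curvatureC linearNl.
have K_diag u v w : K u v w w = 0 by apply/eqP; rewrite -eqNr -K_skew.
have K_alt u v w : K u u v w = 0 by rewrite KE curvature_alt zero_lfunE linear0l.
have Ric u v : <<ricci g u, v>> = K u e v e / p + K u f1 v f1 / q + K u f2 v f2 / r.
  by rewrite ricci_frame !KE.
have coef0 (x y : R) : y != 0 -> 0 = x / y -> x = 0.
  move=> y0 /esym/eqP.
  by rewrite mulf_eq0 invr_eq0 (negPf y0) orbF => /eqP.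
have Kcoef u v w x (y : R) : y != 0 -> 0 = K u v w x / y -> K u v x w = 0.
  by move=> y0 /coef0 K0; rewrite K_skew K0 ?oppr0.
have simplK := (K_diag, K_alt, mul0r, mulr0, addr0, add0r).
have Ree := Ric e e; have R11 := Ric f1 f1; have R22 := Ric f2 f2.
have Re1 := Ric e f1; have Re2 := Ric e f2; have R12 := Ric f1 f2.
have R1e := Ric f1 e; have R2e := Ric f2 e.
rewrite Re !linear0l !simplK in Ree Re1 Re2.
rewrite Rf1 !ipZl ?f1e ?f12 !simplK in R11 R12 R1e.
rewrite Rf2 !ipZl ?f2e !simplK in R22 R2e.
have K1e := KC f1 e f1; have K2e := KC f2 e f2; have K21 := KC f2 f1 f2.
rewrite K1e K_skew opprK -/q in R11.
rewrite K2e K21 !(K_skew _ _ f2) !opprK -/r in R22.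
set kpq := K e f1 e f1 in Ree R11; set kpr := K e f2 e f2 in Ree R22.
set kqr := K f1 f2 f1 f2 in R11 R22.
have kpq0 : kpq = 0.
  apply: (@mulfI _ 2); first by rewrite pnatr_eq0.
  (* This combination of the diagonal Ricci equations isolates 2 [kpq]. It is 0 because f1 and f2
     share the eigenvalue lam. *)
  transitivity (q * (kpq / q + kpr / r) + p * (kpq / p + kqr / r)
    - p * q / r * (kpr / p + kqr / q)).
    by field; rewrite e0 f10 f20.
  by rewrite -Ree -R11 -R22; field.
have kpr0 : kpr = 0 by apply: (coef0 _ r) => //; rewrite Ree kpq0 mul0r add0r.
have kqrE : kqr = lam * q * r by rewrite R11 kpq0 mul0r add0r divfK.
have K1_12 : K e f1 f1 f2 = 0 by apply: (Kcoef _ _ _ _ q).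
have K2_12 : K e f2 f1 f2 = 0 by apply: (coef0 _ r).
have K1_e2 : K e f1 e f2 = 0.
  by move: R12; rewrite KC K_skew opprK; apply: coef0.
have K2_e1 : K e f2 e f1 = 0.
  have := Ric f2 f1; rewrite Rf2 ipZl f21 !simplK KC K_skew opprK.
  exact: coef0.
have K12_e2 : K f1 f2 e f2 = 0 by apply: (coef0 _ r).
have K12_e1 : K f1 f2 e f1 = 0.
  by rewrite KC (coef0 _ _ f10 R2e) oppr0.
split; rewrite -?KE //; apply: skew_eq0 => [x y|||]; by rewrite -!KE.
Qed.

(* In the notation of [flat_axis_coefs], B is the matrix of [x |-> x ** e] on
   the plane [f1, f2], while [m1], [m2] and [d] are the rotation coefficients
   of [f1], [f2] and [e] in that plane. *)
Lemma axis_parallel :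
    e ** e = 0 -> curvature e f1 = 0 -> curvature e f2 = 0 ->
    <<curvature f1 f2 e, f1>> = 0 -> <<curvature f1 f2 e, f2>> = 0 ->
    <<curvature f1 f2 f1, f2>> != 0 ->
  forall x, e ** x = 0 /\ x ** e = 0.
Proof.
move=> ee K1 K2 K12_e1 K12_e2 K12.
have lc_diag x y : <<x ** y, y>> = 0.
  by apply/eqP; rewrite -eqNr {2}levi_civita_skew (ipC y).
have [p0 q0 r0] : [/\ p != 0, q != 0 & r != 0] by [].
(* By skewness each of the left products by e, f1, f2 has three free coefficients; e ** e = 0 leaves
   seven in all. Dividing by two norms makes the product table polynomial in these coefficients and
   p, q, r. *)
pose d := <<e ** f1, f2>> / (q * r).
pose m1 := <<f1 ** f1, f2>> / (q * r); pose m2 := <<f2 ** f1, f2>> / (q * r).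
pose B11 := <<f1 ** e, f1>> / (p * q); pose B12 := <<f1 ** e, f2>> / (p * r).
pose B21 := <<f2 ** e, f1>> / (p * q); pose B22 := <<f2 ** e, f2>> / (p * r).
have lc_e x : x ** e = (p * (<<x ** e, f1>> / (p * q))) *: f1
                     + (p * (<<x ** e, f2>> / (p * r))) *: f2.
  rewrite [LHS]frameE lc_diag mul0r scale0r add0r.
  by congr (_ *: _ + _ *: _); field; rewrite ?p0 ?q0 ?r0.
have lc_1 x : x ** f1 = (- (<<x ** e, f1>> / (p * q)) * q) *: e
                      + (<<x ** f1, f2>> / (q * r) * q) *: f2.
  rewrite [LHS]frameE lc_diag mul0r scale0r addr0 levi_civita_skew (ipC f1).
  by congr (_ *: _ + _ *: _); field; rewrite ?p0 ?q0 ?r0.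
have lc_2 x : x ** f2 = (- (<<x ** e, f2>> / (p * r)) * r) *: e
                      + (- (<<x ** f1, f2>> / (q * r)) * r) *: f1.
  rewrite [LHS]frameE lc_diag mul0r scale0r addr0 !(levi_civita_skew x f2).
  rewrite !(ipC f2).
  by congr (_ *: _ + _ *: _); field; rewrite ?p0 ?q0 ?r0.
have e1 : e ** f1 = (d * q) *: f2.
  by rewrite lc_1 ee linear0l mul0r oppr0 mul0r scale0r add0r.
have e2 : e ** f2 = (- d * r) *: f1.
  by rewrite lc_2 ee linear0l mul0r oppr0 mul0r scale0r add0r.
have [H1e H2e] := (lc_e f1, lc_e f2); rewrite -/B11 -/B12 in H1e.
rewrite -/B21 -/B22 in H2e.
have [H11 H21] := (lc_1 f1, lc_1 f2); rewrite -/B11 -/m1 in H11.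
rewrite -/B21 -/m2 in H21.
have [H12 H22] := (lc_2 f1, lc_2 f2); rewrite -/B12 -/m1 in H12.
rewrite -/B22 -/m2 in H22.
clearbody d m1 m2 B11 B12 B21 B22.
have curv u v w x : <<curvature u v w, x>> = <<(u ** v - v ** u) ** w, x>>
    + <<v ** w, u ** x>> - <<u ** w, v ** x>>.
  by rewrite curvature_ip bracketE.
(* With an opaque product, unification does not unfold [levi_civita]. *)
have [lc lcE] : exists lc : g -> g -> g, forall u v, levi_civita u v = lc u v.
  by eexists.
have lcD x y z : lc (x + y) z = lc x z + lc y z.
  by rewrite -!lcE linearD add_lfunE.
have lcN x z : lc (- x) z = - lc x z.
  by rewrite -!lcE linearN opp_lfunE.
have lcZ (a : R) x z : lc (a *: x) z = a *: lc x z.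
  by rewrite -!lcE linearZ /= scale_lfunE.
have {}curv u v w x : <<curvature u v w, x>> = <<lc (lc u v - lc v u) w, x>>
    + <<lc v w, lc u x>> - <<lc u w, lc v x>>.
  by rewrite curv !lcE.
move: (ee) (e1) (e2) (H1e) (H11) (H12) (H2e) (H21) (H22); rewrite !lcE.
move=> lee le1 le2 l1e l11 l12 l2e l21 l22.
have ipNl x z : <<- x, z>> = - <<x, z>> by rewrite linearNl.
have values := (lee, le1, le2, l1e, l11, l12, l2e, l21, l22).
have expand := (values, lcD, lcN, lcZ, bilin, ipNl, ipE, linear0l).
have eq0 (y z k : R) : y != 0 -> z = 0 -> z = y * k -> k = 0.
  by move=> y0 -> /esym/eqP; rewrite mulf_eq0 (negPf y0) => /eqP.
have vanish (A : 'End(g)) x y : A = 0 -> <<A x, y>> = 0.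
  by move=> ->; rewrite zero_lfunE linear0l.
have pq0 : p * q != 0 by rewrite mulf_neq0.
have pr0 : p * r != 0 by rewrite mulf_neq0.
have qr0 : q * r != 0 by rewrite mulf_neq0.
(* Each hypothesis of [flat_axis_coefs] is a curvature component divided by the nonzero product of
   two norms. *)
have [| | | | | | | | |B11_0 B12_0 B21_0 B22_0 d0] :=
  @flat_axis_coefs R p q r B11 B12 B21 B22 m1 m2 d p0 q0 r0.
- by apply: (eq0 _ _ _ pq0 (vanish _ e f1 K1));
    rewrite curv !expand -/p -/q -/r; ring.
- by apply: (eq0 _ _ _ pr0 (vanish _ e f2 K1));
    rewrite curv !expand -/p -/q -/r; ring.
- by apply: (eq0 _ _ _ qr0 (vanish _ f1 f2 K1));
    rewrite curv !expand -/p -/q -/r; ring.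
- by apply: (eq0 _ _ _ pq0 (vanish _ e f1 K2));
    rewrite curv !expand -/p -/q -/r; ring.
- by apply: (eq0 _ _ _ pr0 (vanish _ e f2 K2));
    rewrite curv !expand -/p -/q -/r; ring.
- by apply: (eq0 _ _ _ qr0 (vanish _ f1 f2 K2));
    rewrite curv !expand -/p -/q -/r; ring.
- by apply: (eq0 _ _ _ pq0 K12_e1);
    rewrite curv !expand -/p -/q -/r; ring.
- by apply: (eq0 _ _ _ pr0 K12_e2);
    rewrite curv !expand -/p -/q -/r; ring.
- apply: contra_neq K12 => k0; rewrite -(mulr0 (q * r)) -[in RHS]k0.
  by rewrite curv !expand -/p -/q -/r; ring.
move=> x; have [a [b [c ->] ] ] := frame x.
rewrite !lcE !lcD !lcZ -!lcE !linearD !linearZ /= ee e1 e2 H1e H2e.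
rewrite B11_0 B12_0 B21_0 B22_0 d0 oppr0 !mulr0 !mul0r.
by rewrite !(scale0r, addr0, scaler0).
Qed.

End OrthogonalFrame.
End LeviCivita.

(** * The product decomposition *)

Theorem proposition5p2 (R : realType) (g : lorentzLieAlgebra R) (lam : R) :
  semi_symmetric g -> type_S30 g lam ->
  [/\ (forall u v : g, u \in ricci_space0 g ->
         levi_civita u v = 0 /\ levi_civita v u = 0),
      levi_civita_ideal (ricci_space g lam)
    & lie_product (ricci_space0 g) (ricci_space g lam)].
Proof.
move=> _ [[dim3 lam0 [sum_full dsum orth] dim1] [_ g0_stable] ].
set g0 := ricci_space0 g in sum_full dsum orth dim1 g0_stable *.
set gl := ricci_space g lam in sum_full dsum orth *.
have ipC := @ipC R g.
have dim2 : \dim gl = 2%N.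
  apply: (@addnI 1%N); rewrite -[in LHS]dim1 -[RHS]dim3 -sum_full.
  by apply/esym/eqP; rewrite -directvE.
have split x : exists y z, [/\ y \in g0, z \in gl & x = y + z].
  have /memv_addP[y yg0 [z zgl ->] ] : x \in (g0 + gl)%VS by rewrite sum_full memvf.
  by exists y, z.
pose e := vpick g0; have eg0 : e \in g0 := memv_pick g0.
have e_neq0 : e != 0 by rewrite vpick0 -dimv_eq0 dim1.
have g0E x : x \in g0 -> exists a, x = a *: e.
  suff -> : g0 = <[e]>%VS by move=> /vlineP.
  by apply/esym/eqP; rewrite eqEdim -memvE eg0 dim_vline e_neq0 dim1.
have ip_e y : y \in gl -> ip g e y = 0 by apply: orth.
(* An isotropic e would be orthogonal to both summands, hence to all of g. *)
have ee : ip g e e != 0.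
  apply: contra_neq e_neq0 => ee; apply: ip_nondegenerate => x.
  have [y [z [/g0E[a ->] zgl ->] ] ] := split x.
  by rewrite linearDr linearZr_LR /= ee ip_e // mulr0 addr0.
have gl_nondeg x : x \in gl -> {in gl, forall y, ip g x y = 0} -> x = 0.
  move=> xgl x0; apply: ip_nondegenerate => z.
  have [y [t [/g0E[a ->] tgl ->] ] ] := split z.
  by rewrite linearDr linearZr_LR /= ipC ip_e // x0 // mulr0 addr0.
have glP x : ip g x e = 0 -> x \in gl.
  have [y [z [/g0E[a ->] zgl ->] ] ] := split x.
  rewrite linearDl linearZl_LR /= (ipC z) ip_e // addr0 => /eqP.
  by rewrite mulf_eq0 (negPf ee) orbF => /eqP ->; rewrite scale0r add0r.
have [f1 [f2 [ [f1gl f2gl] [f11 f22 f12] glE] ] ] :=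
  orthogonal_plane_basis dim2 gl_nondeg.
have frame x : exists a b c, x = a *: e + b *: f1 + c *: f2.
  have [y [z [/g0E[a ->] /glE[b [c ->] ] ->] ] ] := split x.
  by exists a, b, c; rewrite addrA.
have ricci_gl f : f \in gl -> ricci g f = lam *: f.
  rewrite memv_ker !(add_lfunE, opp_lfunE, scale_lfunE, id_lfunE) subr_eq0.
  by move/eqP.
(* Only Ric^2 vanishes on [g0] by definition, but Ric maps this line to itself, so Ric e = c e with
   c^2 = 0. *)
have ricci_e : ricci g e = 0.
  have RRe : ricci g (ricci g e) = 0.
    by move: eg0; rewrite memv_ker comp_lfunE => /eqP.
  have /g0E[c Re] : ricci g e \in g0.
    by rewrite memv_ker comp_lfunE RRe linear0.
  move: RRe; rewrite Re linearZ /= Re scalerA => /eqP.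
  by rewrite scaler_eq0 (negPf e_neq0) orbF mulf_eq0 orbb => /eqP ->; rewrite scale0r.
(* The product e.e is a multiple of e, and by skewness it is orthogonal to the nonisotropic e. *)
have e_e : levi_civita e e = 0.
  have /g0E[c ecE] := g0_stable e e eg0 eg0.
  have : ip g (levi_civita e e) e = 0.
    by apply/eqP; rewrite -eqNr {2}levi_civita_skew ipC.
  rewrite ecE linearZl_LR /= => /eqP; rewrite mulf_eq0 (negPf ee) orbF.
  by move=> /eqP ->; rewrite scale0r.
have [ef1 ef2] := (ip_e _ f1gl, ip_e _ f2gl).
have [K1 K2 K12_e1 K12_e2 K12] := curvature_split ee f11 f22 ef1 ef2 f12 frame
  ricci_e (ricci_gl _ f1gl) (ricci_gl _ f2gl).
have K12_0 : ip g (curvature f1 f2 f1) f2 != 0 by rewrite K12 !mulf_neq0.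
have par := axis_parallel ee f11 f22 ef1 ef2 f12 frame e_e K1 K2 K12_e1 K12_e2 K12_0.
have par0 u v : u \in g0 -> levi_civita u v = 0 /\ levi_civita v u = 0.
  move=> /g0E[a ->]; have [ev ve] := par v.
  by rewrite !linearZ /= scale_lfunE ev ve scaler0.
(* Since [gl] is the orthogonal of e, u.e = 0 and skewness put every product u.v in [gl]. *)
have lc_gl u v : levi_civita u v \in gl.
  by apply: glP; rewrite levi_civita_skew (par u).2 linear0r oppr0.
have bracket_gl u v : bracket g u v \in gl by rewrite bracketE memvB.
have bracket0 u v : u \in g0 -> bracket g u v = 0.
  by move=> ug0; have [uv vu] := par0 u v ug0; rewrite bracketE uv vu subrr.
split=> //; split=> //.
  by move=> x y xg0 _; rewrite bracket0 ?mem0v.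
move=> x1 x2 y1 y2 x1g0 x2g0 _ _.
rewrite linearDl !linearDr /= (bracketC y1 x2).
by rewrite !(bracket0 x1) // (bracket0 x2) // oppr0 !add0r.
Qed.
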